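(* Let $U \subset \mathbb{R}^n$ be an open convex set and let $f \colon U \to \mathbb{R}$ be a convex function. Suppose $(x_k)_{k\ge 0}$ is a BFGS sequence for $f$ contained in $U$, and that the level set $\{x \in U : f(x) \le f(x_0)\}$ is bounded. Assume there is an open set $V \subset U$ containing the closure $\mathrm{cl}\,\{x_k : k\ge 0\}$ and satisfying $\inf_{x \in V} f(x) = \min f$, such that for every constant $\delta > 0$ there exist a convex open set $U_\delta \subset U$ containing $\{x \in U : f(x) \le f(x_0)\}$ and a twice continuously differentiable convex function $f_\delta \colon U_\delta \to \mathbb{R}$ with $f_\delta(x) = f(x)$ for all $x \in U_\delta$ satisfying $d_{V^c}(x) > \delta$. Then the sequence of function values $f(x_k)$ converges to $\min f$.
   Context: Here $\min f$ denotes the minimum (infimum) value of $f$ over $U$; $V^c = \mathbb{R}^n \setminus V$, and $d_{V^c}(x) = \inf_{z \in V^c}\|z - x\|$ is the Euclidean distance from $x$ to $V^c$. A sequence $(x_k)$ is a BFGS sequence for $f$ if $f$ is differentiable at each $x_k$ with $\nabla f(x_k) \neq 0$, and there exist parameters $0<\mu<\nu<1$ and a positive definite $n\times n$ matrix $H_0$ such that, with $s_k = x_{k+1}-x_k$, $y_k = \nabla f(x_{k+1}) - \nabla f(x_k)$, $V_k = I - \frac{s_k y_k^T}{s_k^T y_k}$ and $H_{k+1} = V_k H_k V_k^T + \frac{s_k s_k^T}{s_k^T y_k}$, one has for all $k=0,1,2,\dots$: $H_k \nabla f(x_k) \in -\mathbb{R}_+ s_k$, $f(x_{k+1}) \le f(x_k)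 + \mu \nabla f(x_k)^T s_k$, and $\nabla f(x_{k+1})^T s_k \ge \nu \nabla f(x_k)^T s_k$. *)

(* Defs.v *)
From HB Require Import structures.
From mathcomp Require Import all_boot all_order all_algebra.
From mathcomp Require Import all_classical all_reals all_analysis.
Set Implicit Arguments. Unset Strict Implicit. Unset Printing Implicit Defensive.
Import Order.TTheory GRing.Theory Num.Theory.
Import numFieldNormedType.Exports.
Local Open Scope classical_set_scope.
Local Open Scope ring_scope.

Section Defs.
Variables (R : realType) (n : nat).
Notation vec := 'cV[R]_n.

Definition dotv (u v : vec) : R := \sum_(i < n) u i 0 * v i 0.
Definition enorm (u : vec) : R := Num.sqrt (dotv u u).

Definition evec (i : 'I_n) : vec := delta_mx i 0.

Definition grad (f : vec -> R) (x : vec) : vec :=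
  \col_(i < n) ('d f x (evec i)).

(* distance from x to the complement of V, in \bar R (= +oo if V^c is empty) *)
Definition dist_compl (V : set vec) (x : vec) : \bar R :=
  ereal_inf [set (enorm (z - x))%:E | z in ~` V].

Definition inf_on (f : vec -> R) (A : set vec) : \bar R :=
  ereal_inf [set (f x)%:E | x in A].

Definition convex_set_R (A : set vec) : Prop :=
  forall x y (t : R), A x -> A y -> 0 <= t <= 1 -> A (t *: x + (1 - t) *: y).

Definition convex_on (A : set vec) (f : vec -> R) : Prop :=
  forall x y (t : R), A x -> A y -> 0 <= t <= 1 ->
    f (t *: x + (1 - t) *: y) <= t * f x + (1 - t) * f y.

Definition ebounded (A : set vec) : Prop :=
  exists M : R, forall x, A x -> enorm x <= M.

Definition C2_on (A : set vec) (f : vec -> R) : Prop :=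
  {within A, continuous f} /\
  (forall i : 'I_n, forall x, A x -> derivable f x (evec i)) /\
  (forall i : 'I_n, {within A, continuous (fun y => 'D_(evec i) f y)}) /\
  (forall i j : 'I_n, forall x, A x ->
     derivable (fun y => 'D_(evec i) f y) x (evec j)) /\
  (forall i j : 'I_n,
     {within A, continuous (fun z => 'D_(evec j) (fun y => 'D_(evec i) f y) z)}).

Definition pos_def (H : 'M[R]_n) : Prop :=
  H^T = H /\ forall v : vec, v != 0 -> 0 < dotv v (H *m v).

(* BFGS inverse-Hessian update *)
Definition bfgs_update (f : vec -> R) (x : nat -> vec) (k : nat) (H : 'M[R]_n)
  : 'M[R]_n :=
  let s := x k.+1 - x k in
  let y := grad f (x k.+1) - grad f (x k) in
  let Vk := 1%:M - (dotv s y)^-1 *: (s *m y^T) in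
  Vk *m H *m Vk^T + (dotv s y)^-1 *: (s *m s^T).

Fixpoint bfgs_H (f : vec -> R) (x : nat -> vec) (H0 : 'M[R]_n) (k : nat)
  : 'M[R]_n :=
  match k with
  | 0 => H0
  | k'.+1 => bfgs_update f x k' (bfgs_H f x H0 k')
  end.

Definition bfgs_sequence (f : vec -> R) (x : nat -> vec) : Prop :=
  (forall k, differentiable f (x k) /\ grad f (x k) != 0) /\
  exists (mu nu : R) (H0 : 'M[R]_n),
    [/\ 0 < mu, mu < nu, nu < 1, pos_def H0 &
    forall k : nat,
      let s := x k.+1 - x k in
      [/\ exists t : R, 0 <= t /\ bfgs_H f x H0 k *m grad f (x k) = - (t *: s),
          f (x k.+1) <= f (x k) + mu * dotv (grad f (x k)) s &
          dotv (grad f (x k.+1)) s >= nu * dotv (grad f (x k)) s]].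

End Defs.

(* Main.v *)
Require Import Defs.
From HB Require Import structures.
From mathcomp Require Import all_boot all_order all_algebra.
From mathcomp Require Import all_classical all_reals all_analysis.
From mathcomp Require Import perm ring lra.
Import Order.TTheory GRing.Theory Num.Theory.
Import numFieldNormedType.Exports.
Set Implicit Arguments.
Unset Strict Implicit.
Local Open Scope classical_set_scope.
Local Open Scope ring_scope.

(** Near the compact set [C = closure (range x)] the function coincides with one
    of its C^2 approximations, so it has a quadratic upper model of uniform
    curvature at every point of [C]; since it is convex, Jensen's inequality
    reduces this to second derivatives along the coordinate axes.  With
    convexity this makes the gradient cocoercive along the sequence,
    [|y_k|^2 <= M <s_k, y_k>].  Powell's argument then applies: the trace of
    [H_k^-1] grows at most linearly, its determinant is multiplied by at least
    [(1 - nu) / lambda_k] (where [s_k = - lambda_k H_k g_k]), and the sum of the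
    [- <g_k, s_k>] is finite; by the arithmetic-geometric mean inequality these
    facts are incompatible with a positive lower bound on [|g_k|].  Finally, the
    tangent inequality [f (x_k) <= f z + <g_k, x_k - z>] at bounded [x_k] turns
    [liminf |g_k| = 0] into convergence of the values to the infimum. *)

(** * Euclidean inner product and norm on column vectors *)

Section DotProduct.
Variables (R : realType) (n : nat).
Implicit Types (u v w : 'cV[R]_n) (A : 'M[R]_n).

Lemma mul_tr_col u v : u^T *m v = (dotv u v)%:M.
Proof.
rewrite [LHS]mx11_scalar; congr (_%:M); rewrite mxE.
by apply: eq_bigr => i _; rewrite mxE.
Qed.

Lemma dotvC u v : dotv u v = dotv v u.
Proof. by apply: eq_bigr => i _; rewrite mulrC. Qed.

Lemma dotvDr u v w : dotv u (v + w) = dotv u v + dotv u w.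
Proof. by rewrite -big_split /=; apply: eq_bigr => i _; rewrite mxE mulrDr. Qed.

Lemma dotvZr a u v : dotv u (a *: v) = a * dotv u v.
Proof. by rewrite mulr_sumr; apply: eq_bigr => i _; rewrite mxE mulrCA. Qed.

Lemma dotvNr u v : dotv u (- v) = - dotv u v.
Proof. by rewrite -scaleN1r dotvZr mulN1r. Qed.

Lemma dotvBr u v w : dotv u (v - w) = dotv u v - dotv u w.
Proof. by rewrite dotvDr dotvNr. Qed.

Lemma dotvDl u v w : dotv (u + v) w = dotv u w + dotv v w.
Proof. by rewrite dotvC dotvDr !(dotvC w). Qed.

Lemma dotvZl a u v : dotv (a *: u) v = a * dotv u v.
Proof. by rewrite dotvC dotvZr dotvC. Qed.

Lemma dotvNl u v : dotv (- u) v = - dotv u v.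
Proof. by rewrite dotvC dotvNr dotvC. Qed.

Lemma dotvBl u v w : dotv (u - v) w = dotv u w - dotv v w.
Proof. by rewrite dotvDl dotvNl. Qed.

Lemma dotv0r u : dotv u 0 = 0.
Proof. by rewrite -[0](scale0r 0) dotvZr mul0r. Qed.

Lemma dotv_ge0 u : 0 <= dotv u u.
Proof. by apply: sumr_ge0 => i _; rewrite -expr2 sqr_ge0. Qed.

Lemma dotv_eq0 u : (dotv u u == 0) = (u == 0).
Proof.
apply/eqP/eqP => [uu0|->]; last exact: dotv0r.
apply/colP => i; rewrite mxE; apply/eqP; rewrite -sqrf_eq0 expr2; apply/eqP.
have uu_ge0 j : true -> 0 <= u j 0 * u j 0 by rewrite -expr2 sqr_ge0.
exact: (psumr_eq0P uu_ge0 uu0).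
Qed.

Lemma dotv_gt0 u : (0 < dotv u u) = (u != 0).
Proof. by rewrite lt_def dotv_ge0 andbT dotv_eq0. Qed.

Lemma dotv_mulmx u A v : dotv u (A *m v) = dotv (A^T *m u) v.
Proof.
have : (dotv u (A *m v))%:M = (dotv (A^T *m u) v)%:M :> 'M[R]_1.
  by rewrite -!mul_tr_col trmx_mul trmxK mulmxA.
by move/(congr1 (fun M : 'M[R]_1 => M 0 0)); rewrite !mxE.
Qed.

Lemma mul_col_tr u v w : u *m v^T *m w = dotv v w *: u.
Proof. by rewrite -mulmxA mul_tr_col mul_mx_scalar. Qed.

Lemma mxtrace_mul_col_tr u v : \tr (u *m v^T) = dotv v u.
Proof. by rewrite mxtrace_mulC mul_tr_col mxtrace_scalar. Qed.

Lemma sqr_enorm u : enorm u ^+ 2 = dotv u u.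
Proof. by rewrite sqr_sqrtr ?dotv_ge0. Qed.

Lemma enorm_ge0 u : 0 <= enorm u.
Proof. exact: sqrtr_ge0. Qed.

Lemma enormN u : enorm (- u) = enorm u.
Proof. by rewrite /enorm dotvNl dotvNr opprK. Qed.

(** This is [0 <= |r u - v|^2] divided by [r]. *)
Lemma dotv_young u v (r : R) : 0 < r ->
  2 * dotv u v <= r * dotv u u + r^-1 * dotv v v.
Proof.
move=> r0; have := dotv_ge0 (r *: u - v).
rewrite dotvBl !dotvBr !dotvZl !dotvZr (dotvC v u) => h.
rewrite -(ler_pM2l r0) mulrDr (mulrA r r^-1) divff ?gt_eqF// mul1r; lra.
Qed.

Lemma dotv_le_enorm u v : dotv u v <= enorm u * enorm v.
Proof.
have [->|u0] := eqVneq u 0.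
  by rewrite dotvC dotv0r mulr_ge0 ?enorm_ge0.
have [->|v0] := eqVneq v 0; first by rewrite dotv0r mulr_ge0 ?enorm_ge0.
have eu : 0 < enorm u by rewrite sqrtr_gt0 dotv_gt0.
have ev : 0 < enorm v by rewrite sqrtr_gt0 dotv_gt0.
(* This weight makes the two terms of Young's bound equal. *)
have := @dotv_young u v (enorm v / enorm u) (divr_gt0 ev eu).
rewrite -!sqr_enorm invf_div.
have -> : enorm v / enorm u * enorm u ^+ 2 + enorm u / enorm v * enorm v ^+ 2 =
  2 * (enorm u * enorm v) by field; rewrite !gt_eqF.
by rewrite ler_pM2l.
Qed.

Lemma abs_coord_le_enorm u i : `|u i 0| <= enorm u.
Proof.
rewrite -sqrtr_sqr ler_sqrt ?dotv_ge0// /dotv (bigD1 i)//= -expr2 lerDl.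
by apply: sumr_ge0 => j _; rewrite -expr2 sqr_ge0.
Qed.

Lemma norm_colE u :
  `|u| = \big[Num.max/0]_(ij : 'I_n * 'I_1) `|u ij.1 ij.2|.
Proof. exact: mx_normrE. Qed.

Lemma norm_le_enorm u : `|u| <= enorm u.
Proof.
rewrite norm_colE; apply: bigmax_le; first exact: enorm_ge0.
by move=> [i j] _ /=; rewrite (ord1 j) abs_coord_le_enorm.
Qed.

End DotProduct.

(** * Positive definite matrices: inverses, and trace bounds for entries and determinant *)

Section PositiveDefinite.
Variables (R : realType) (n : nat).
Implicit Types (H B : 'M[R]_n) (s y u v w : 'cV[R]_n).

(** Both sides of [e] equal the block matrix with rows [1, s] and [w^T, 1]; the determinants of the
    triangular factors give the claim. *)
Lemma det_sub_rank1 s w : \det (1%:M - s *m w^T) = 1 - dotv w s.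
Proof.
have e : block_mx 1%:M 0 w^T 1%:M *m
    block_mx 1%:M s 0 (1%:M - (dotv w s)%:M) =
  block_mx (1%:M - s *m w^T) s 0 1%:M *m block_mx 1%:M 0 w^T 1%:M
  :> 'M[R]_(n + 1).
  rewrite !mulmx_block !mulmx0 !mul0mx !mul1mx !mulmx1 !addr0 !add0r.
  by rewrite mul_tr_col subrK addrC subrK.
have := congr1 (fun M => \det M) e.
rewrite !det_mulmx !det_ublock !det_lblock !det1 !mul1r !mulr1 => <-.
by rewrite det_mx11 !mxE eqxx.
Qed.

Lemma pos_def_unit H : pos_def H -> H \in unitmx.
Proof.
move=> [Hsym Hpos]; rewrite unitmxE unitfE; apply/negP => /det0P[v v0 vH].
have tv0 : v^T != 0 by rewrite trmx_eq0.
have := Hpos _ tv0; rewrite -{1}Hsym -trmx_mul vH trmx0 dotv0r.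
by rewrite ltxx.
Qed.

Lemma pos_def_ge0 H v : pos_def H -> 0 <= dotv v (H *m v).
Proof.
move=> [_ Hpos]; have [->|/Hpos/ltW//] := eqVneq v 0.
by rewrite mulmx0 dotv0r.
Qed.

Lemma pos_def_inv H : pos_def H -> pos_def (invmx H).
Proof.
move=> Hpd; have Hu := pos_def_unit Hpd; case: (Hpd) => [Hsym Hpos].
have Bsym : (invmx H)^T = invmx H by rewrite trmx_inv Hsym.
split=> // v v0; rewrite dotv_mulmx Bsym -{2}[v](mulKVmx Hu).
apply: Hpos; apply: contraNneq v0 => Bv0.
by rewrite -[v](mulKVmx Hu) Bv0 mulmx0.
Qed.

Lemma dotv_evec H i j : dotv (evec R i) (H *m evec R j) = H i j.
Proof.
rewrite /dotv (bigD1 i)//= big1 ?addr0.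
  by rewrite mxE !eqxx mul1r -colE mxE.
by move=> k ki; rewrite mxE (negPf ki) mul0r.
Qed.

(** Nonnegativity of the form at [e_i + e_j] and [e_i - e_j] gives [2 |B i j| <= B i i + B j j], and
    each diagonal entry is at most the trace. *)
Lemma pos_def_abs_le_trace B i j : pos_def B -> `|B i j| <= \tr B.
Proof.
move=> Bpd; have [Bsym _] := Bpd.
have Bdiag k : 0 <= B k k by rewrite -dotv_evec pos_def_ge0.
have Bdiag_le k : B k k <= \tr B.
  by rewrite /mxtrace (bigD1 k)//= lerDl sumr_ge0.
have q c : 0 <= B i i + c * (B i j + B j i) + c ^+ 2 * B j j.
  have := pos_def_ge0 (evec R i + c *: evec R j) Bpd.
  rewrite mulmxDr -scalemxAr dotvDl !dotvDr !dotvZl !dotvZr !dotv_evec => h; lra.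
have Bji : B j i = B i j by rewrite -{1}Bsym mxE.
rewrite ler_norml; have := q 1; have := q (- 1); rewrite Bji.
have := Bdiag_le i; have := Bdiag_le j; lra.
Qed.

Lemma pos_def_trace_ge0 B : pos_def B -> 0 <= \tr B.
Proof. by move=> Bpd; apply: sumr_ge0 => i _; rewrite -dotv_evec pos_def_ge0. Qed.

(** Each of the [n!] terms of the Leibniz expansion is at most [\tr B ^+ n]. The constant is crude,
    but only polynomial growth in the trace matters later. *)
Lemma pos_def_det_le_trace B : pos_def B ->
  `|\det B| <= n`!%:R * \tr B ^+ n.
Proof.
move=> Bpd; apply: le_trans (ler_norm_sum _ _ _) _.
rewrite -card_Sn mulr_natl -sumr_const.
apply: ler_sum => p _; rewrite normrM normrX normrN1 expr1n mul1r normr_prod.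
rewrite -[X in \tr B ^+ X](card_ord n) -prodr_const.
by apply: ler_prod => i _; rewrite normr_ge0 pos_def_abs_le_trace.
Qed.

End PositiveDefinite.

(** * One BFGS update: positive definiteness, inverse, trace and determinant *)

Section BfgsStep.
Variables (R : realType) (n : nat) (H : 'M[R]_n) (s y : 'cV[R]_n).
Hypotheses (Hpd : pos_def H) (sy_gt0 : 0 < dotv s y).

Let B := invmx H.
Let tau := dotv s y.
Let sigma := dotv s (B *m s).
Let V := 1%:M - tau^-1 *: (s *m y^T).
Let H' := V *m H *m V^T + tau^-1 *: (s *m s^T).
(** The BFGS update in its direct form, for the Hessian approximation [B]. *)
Let B' := B - sigma^-1 *: (B *m s *m (B *m s)^T) + tau^-1 *: (y *m y^T).

Let tau_neq0 : tau != 0. Proof. by rewrite gt_eqF. Qed.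

Let s_neq0 : s != 0.
Proof. by apply: contraTneq sy_gt0 => ->; rewrite dotvC dotv0r ltxx. Qed.

Let Bpd : pos_def B. Proof. exact: pos_def_inv. Qed.

Let sigma_gt0 : 0 < sigma. Proof. by case: Bpd => _; apply. Qed.

Let Hu : H \in unitmx. Proof. exact: pos_def_unit. Qed.

Let trV : V^T = 1%:M - tau^-1 *: (y *m s^T).
Proof. by rewrite /V linearB linearZ/= trmx1 trmx_mul trmxK. Qed.

Let Vs : V *m s = 0.
Proof.
rewrite mulmxBl mul1mx -scalemxAl mul_col_tr (dotvC y) scalerA mulVf//.
by rewrite scale1r subrr.
Qed.

Let trVy : V^T *m y = 0.
Proof.
rewrite trV mulmxBl mul1mx -scalemxAl mul_col_tr scalerA mulVf//.
by rewrite scale1r subrr.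
Qed.

(** The form of [H'] at [v] is that of [H] at [V^T v] plus [<s, v>^2 / tau]. If the square vanishes
    then [V^T v = v], so one of the two terms is positive. *)
Lemma bfgs_step_pos_def : pos_def H'.
Proof.
have [Hsym Hpos] := Hpd; split.
  by rewrite /H' linearD/= linearZ/= !trmx_mul !trmxK Hsym mulmxA.
move=> v v0.
have -> : dotv v (H' *m v) =
    dotv (V^T *m v) (H *m (V^T *m v)) + tau^-1 * dotv s v ^+ 2.
  rewrite mulmxDl dotvDr -scalemxAl mul_col_tr !dotvZr (dotvC v s) -expr2.
  by rewrite -!mulmxA (dotv_mulmx v V).
have [sv0|sv0] := eqVneq (dotv s v) 0.
  rewrite trV mulmxBl mul1mx -scalemxAl mul_col_tr sv0 scale0r scaler0 subr0.
  by rewrite expr0n/= mulr0 addr0 Hpos.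
apply: ltr_wpDl; first exact: pos_def_ge0.
by rewrite mulr_gt0 ?invr_gt0// exprn_even_gt0.
Qed.

(** [H'] satisfies the secant equation [H' y = s], and the part [C] of [B'] without the [y] term
    annihilates [s], so [C H' = V^T]; adding [y s^T / tau] gives the identity. *)
Lemma bfgs_step_inv : invmx H' = B'.
Proof.
have [Bsym _] := Bpd.
have H'u : H' \in unitmx by apply: pos_def_unit; exact: bfgs_step_pos_def.
have H'y : y^T *m H' = s^T.
  rewrite /H' mulmxDr -!mulmxA [y^T *m (V *m _)]mulmxA.
  have -> : y^T *m V = 0 by rewrite -[V]trmxK -trmx_mul trVy trmx0.
  rewrite mul0mx add0r -scalemxAr mulmxA mul_tr_col (dotvC y) mul_scalar_mx.
  by rewrite scalerA mulVf// scale1r.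
pose C := B - sigma^-1 *: (B *m s *m (B *m s)^T).
have Cs : C *m s = 0.
  rewrite mulmxBl -scalemxAl mul_col_tr (dotvC _ s) scalerA mulVf ?gt_eqF//.
  by rewrite scale1r subrr.
have CV : C *m V = C.
  by rewrite mulmxBr mulmx1 -scalemxAr mulmxA Cs mul0mx scaler0 subr0.
have CHV : C *m H *m V^T = V^T.
  rewrite mulmxBl mulVmx// mulmxBl mul1mx -!scalemxAl.
  rewrite trmx_mul Bsym -!mulmxA mulKmx//.
  by rewrite -trmx_mul Vs trmx0 !mulmx0 scaler0 subr0.
have BH : B' *m H' = 1%:M.
  rewrite /B' -/C mulmxDl -scalemxAl -mulmxA H'y {1}/H' mulmxDr.
  rewrite -!mulmxA [C *m (V *m _)]mulmxA CV mulmxA CHV.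
  by rewrite -scalemxAr mulmxA Cs mul0mx scaler0 addr0 trV subrK.
by rewrite -[LHS]mul1mx -BH -mulmxA mulmxV// mulmx1.
Qed.

Lemma bfgs_step_trace : \tr (invmx H') =
  \tr (invmx H) - dotv (B *m s) (B *m s) / sigma + dotv y y / tau.
Proof.
rewrite bfgs_step_inv !mxtraceD raddfN/= !mxtraceZ !mxtrace_mul_col_tr.
by rewrite (mulrC sigma^-1) (mulrC tau^-1).
Qed.

(* [H'] is also the congruence [W H W^T] by a rank-one perturbation [W] of the
   identity, which reduces the determinant to [det_sub_rank1]. *)
Lemma bfgs_step_det : \det (invmx H') = \det (invmx H) * (tau / sigma).
Proof.
have [Bsym _] := Bpd.
(* With this [k] the coefficient [k^2 sigma / tau^2] of [s s^T] in [W H W^T] becomes the required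
   [1 / tau]. *)
pose k := Num.sqrt (tau / sigma).
have k2 : k * k = tau / sigma by rewrite -expr2 sqr_sqrtr// divr_ge0// ltW.
pose w := tau^-1 *: (y + k *: (B *m s)).
pose W := 1%:M - s *m w^T.
have WE : W = V - (tau^-1 * k) *: (s *m (B *m s)^T).
  have wT : w^T = tau^-1 *: y^T + (tau^-1 * k) *: (B *m s)^T.
    by rewrite /w scalerDr scalerA [LHS]linearD !linearZ.
  by rewrite /W wT mulmxDr -!scalemxAr opprD addrA.
have H'E : H' = W *m H *m W^T.
  have WH : W *m H = V *m H - (tau^-1 * k) *: (s *m s^T).
    by rewrite WE mulmxBl -scalemxAl trmx_mul Bsym -!mulmxA mulVmx// mulmx1.
  have WT : W^T = V^T - (tau^-1 * k) *: (B *m s *m s^T).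
    by rewrite WE linearB linearZ/= trmx_mul trmxK.
  rewrite WH WT mulmxBl !mulmxBr -!scalemxAl -!scalemxAr.
  have -> : V *m H *m (B *m s *m s^T) = 0.
    by rewrite -!mulmxA mulKVmx// mulmxA Vs mul0mx.
  have -> : s *m s^T *m V^T = 0 by rewrite -mulmxA -trmx_mul Vs trmx0 mulmx0.
  have -> : s *m s^T *m (B *m s *m s^T) = sigma *: (s *m s^T).
    by rewrite mulmxA mul_col_tr -scalemxAl.
  rewrite !scaler0 subr0 sub0r opprK !scalerA /H'; congr (_ + _ *: _).
  have -> : tau^-1 * k * (tau^-1 * k) * sigma = tau^-1 * tau^-1 * (k * k) * sigma.
    by ring.
  rewrite k2; field; by rewrite tau_neq0 gt_eqF.
have dW : \det W = - (k * sigma / tau).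
  rewrite det_sub_rank1 dotvZl dotvDl dotvZl (dotvC y) (dotvC _ s) -/tau -/sigma.
  by field.
rewrite !det_inv H'E !det_mulmx det_tr dW.
have -> : - (k * sigma / tau) * \det H * - (k * sigma / tau) =
  \det H * ((k * k) * (sigma / tau) ^+ 2) by ring.
rewrite k2; have dH : \det H != 0 by rewrite -unitfE -unitmxE.
by field; rewrite tau_neq0 dH gt_eqF.
Qed.

End BfgsStep.

(** * Real sequences: means, decay and Powell's contradiction *)

Section Powell.
Variable R : realType.

Lemma prod_le_mean (E : nat -> R) (k : nat) : (forall j, 0 <= E j) ->
  \prod_(j < k) E j <= ((\sum_(j < k) E j) / k%:R) ^+ k.
Proof.
move=> E0; have := @leif_AGM R 'I_k predT (fun j => E j) (fun j _ => E0 j).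
by rewrite card_ord => -[].
Qed.

(** For [N] above both thresholds, [(q / N)^N <= 2^(-(n+1) N)] absorbs [N^n <= 2^(n N)], which
    leaves [K / 2^N < D]. *)
Lemma superexponential_decay (n : nat) (q D K : R) : 0 < D -> 0 <= q -> 0 <= K ->
  exists2 k, (0 < k)%N & K * k%:R ^+ n * (q / k%:R) ^+ k < D.
Proof.
move=> D0 q0 K0.
have [N Ngt0] : exists2 N, (0 < N)%N & Num.max (q * 2 ^+ n.+1) (K / D) < N%:R.
  by eexists; [|exact: truncnS_gt].
have N0 : 0 < N%:R :> R by rewrite ltr0n.
rewrite gt_max => /andP[qN KN]; exists N => //.
have N2 : N%:R <= 2 ^+ N :> R by rewrite -natrX ler_nat ltnW// ltn_expl.
have qN2 : q / N%:R <= (2 ^+ n.+1)^-1.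
  by rewrite ler_pdivrMr// mulrC ler_pdivlMr ?exprn_gt0// ltW.
have t0 : 0 < 2 ^+ N :> R by rewrite exprn_gt0.
have e1 : N%:R ^+ n <= (2 ^+ N) ^+ n :> R.
  by rewrite lerXn2r// nnegrE ltW.
have e2 : (q / N%:R) ^+ N <= ((2 ^+ N) ^+ n.+1)^-1.
  by rewrite exprAC -exprVn lerXn2r ?nnegrE ?divr_ge0 ?invr_ge0 ?exprn_ge0.
have e3 : K * N%:R ^+ n * (q / N%:R) ^+ N <= K / 2 ^+ N.
  rewrite -mulrA ler_wpM2l//.
  apply: (@le_trans _ _ ((2 ^+ N) ^+ n * ((2 ^+ N) ^+ n.+1)^-1)).
    by apply: ler_pM => //; rewrite exprn_ge0// ?divr_ge0// ltW.
  by rewrite exprS invfM mulrCA divff ?mulr1// expf_neq0 ?gt_eqF.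
apply: (le_lt_trans e3); rewrite ltr_pdivrMr// mulrC -ltr_pdivrMr//.
exact: lt_le_trans KN N2.
Qed.

(* Powell's product argument: the trace recursion bounds the product of the
   ratios [lam j * b j / a j] by [C ^ k], the determinant recursion bounds the
   product of the [lam j] below by [c ^ k], and the summability of [a] makes
   the product of the [a j] at most [(S / k) ^ k]. *)
Lemma powell_liminf (n : nat) (T D a b lam : nat -> R) (M th C S : R) :
  0 <= C -> 0 <= M -> 0 < th -> 0 <= S ->
  (forall k, 0 <= T k) -> (forall k, 0 < D k) ->
  (forall k, 0 < a k) -> (forall k, 0 < lam k) ->
  (forall k, T k.+1 <= T k - lam k * b k / a k + M) ->
  (forall k, D k * (th / lam k) <= D k.+1) ->
  (forall k, D k <= C * T k ^+ n) ->
  (forall k, \sum_(j < k) a j <= S) ->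
  forall e, 0 < e -> exists k, b k < e.
Proof.
move=> C0 M0 th0 S0 T0 D0 a0 lam0 TS DS DT aS e e0.
apply: contrapT => /forallNP b_ge.
have eb k : e <= b k by rewrite leNgt; apply/negP/b_ge.
(* The trace recursion is summed with [b j] replaced by its assumed lower bound [e]. *)
have Tk k : T k + \sum_(j < k) (lam j * e / a j) <= T 0%N + M * k%:R.
  elim: k => [|k IH]; first by rewrite big_ord0 mulr0 addr0.
  rewrite big_ord_recr/= -natr1 mulrDr mulr1.
  have : lam k * e / a k <= lam k * b k / a k.
    by rewrite ler_pM2r ?invr_gt0// ler_pM2l.
  by move: (TS k) IH; lra.
have Dk k : D 0%N * th ^+ k <= D k * \prod_(j < k) lam j.
  elim: k => [|k IH]; first by rewrite big_ord0 expr0.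
  rewrite big_ord_recr/= exprSr mulrA.
  apply: (le_trans (ler_wpM2r (ltW th0) IH)).
  have -> : D k * \prod_(j < k) lam j * th =
    D k * (th / lam k) * (\prod_(j < k) lam j * lam k).
    by field; rewrite gt_eqF.
  by rewrite ler_wpM2r// ltW// mulr_gt0// prodr_gt0.
(* For [k >= 1] this constant gives [T 0 + M k <= c k]. *)
pose c := T 0%N + M.
have c0 : 0 <= c by rewrite addr_ge0.
(* After division by [(e * th) ^+ k], the upper bound on [D 0] reads [C c^n k^n (q / k)^k], which
   falls below [D 0] for a suitable [k]. *)
pose q := c * S / (e * th).
have q0 : 0 <= q by rewrite divr_ge0 ?mulr_ge0// ltW.
have [k k0] := @superexponential_decay n q (D 0%N) (C * c ^+ n) (D0 0%N) q0
  (mulr_ge0 C0 (exprn_ge0 _ c0)).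
apply/negP; rewrite -leNgt.
have kR : 1 <= k%:R :> R by rewrite ler1n.
have kR0 : 0 < k%:R :> R by rewrite ltr0n.
have ck : T 0%N + M * k%:R <= c * k%:R.
  by rewrite mulrDl lerD2r ler_peMr.
have s0 : 0 <= \sum_(j < k) (lam j * e / a j).
  by apply: sumr_ge0 => j _; rewrite ltW// divr_gt0// mulr_gt0.
have Tck : T k <= c * k%:R by move: (Tk k) s0 ck; lra.
have p1 : \prod_(j < k) (lam j * e / a j) <= c ^+ k.
  apply: (le_trans (@prod_le_mean (fun j => lam j * e / a j) _ _)).
    by move=> j; rewrite ltW// divr_gt0// mulr_gt0.
  rewrite lerXn2r ?nnegrE ?divr_ge0 ?ler0n// ler_pdivrMr//.
  by move: (Tk k) (T0 k) ck; lra.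
have p2 : \prod_(j < k) a j <= (S / k%:R) ^+ k.
  apply: (le_trans (@prod_le_mean a _ _)) => [j|]; first exact: ltW.
  have sa0 : 0 <= \sum_(j < k) a j by apply: sumr_ge0 => j _; rewrite ltW.
  by rewrite lerXn2r ?nnegrE ?divr_ge0 ?ler0n// ler_pM2r ?invr_gt0.
have pe : \prod_(j < k) (lam j * e / a j) * \prod_(j < k) a j =
    \prod_(j < k) lam j * e ^+ k.
  rewrite -big_split/= -[in e ^+ k](card_ord k) -prodr_const -big_split/=.
  by apply: eq_bigr => j _; field; rewrite gt_eqF.
have Dle : D k <= C * (c * k%:R) ^+ n.
  apply: (le_trans (DT k)); rewrite ler_wpM2l// lerXn2r// nnegrE//.
  by rewrite mulr_ge0// ltW.
have plam : \prod_(j < k) lam j * e ^+ k <= c ^+ k * (S / k%:R) ^+ k.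
  rewrite -pe; apply: ler_pM => //; apply: prodr_ge0 => j _; rewrite ltW//.
  by rewrite divr_gt0// mulr_gt0.
have eth : 0 < (e * th) ^+ k by rewrite exprn_gt0 ?mulr_gt0.
rewrite -(ler_pM2r eth).
have -> : C * c ^+ n * k%:R ^+ n * (q / k%:R) ^+ k * (e * th) ^+ k =
    C * (c * k%:R) ^+ n * (c ^+ k * (S / k%:R) ^+ k).
  have hq : q / k%:R * (e * th) = c * (S / k%:R).
    by rewrite /q; field; rewrite !gt_eqF.
  by rewrite -(mulrA _ _ ((e * th) ^+ k)) -(exprMn k (q / k%:R)) hq !exprMn !mulrA.
have -> : D 0%N * (e * th) ^+ k = D 0%N * th ^+ k * e ^+ k.
  by rewrite exprMn mulrA mulrAC.
apply: (le_trans (ler_wpM2r (exprn_ge0 k (ltW e0)) (Dk k))).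
rewrite -[leLHS]mulrA; apply: ler_pM => //; first exact: ltW.
by rewrite mulr_ge0// ?exprn_ge0 ?prodr_ge0// ?ltW// => j _; rewrite ltW.
Qed.

Lemma sum_decrease_le (phi a : nat -> R) (mu m : R) : 0 < mu ->
  (forall k, phi k.+1 <= phi k - mu * a k) -> (forall k, m <= phi k) ->
  forall k, \sum_(j < k) a j <= (phi 0%N - m) / mu.
Proof.
move=> mu0 phiS phim k; rewrite ler_pdivlMr//.
have : (\sum_(j < k) a j) * mu <= phi 0%N - phi k.
  elim: k => [|k IH]; first by rewrite big_ord0 mul0r subrr.
  by rewrite big_ord_recr/= mulrDl; move: IH (phiS k); lra.
by move: (phim k); lra.
Qed.

End Powell.

(** * The BFGS iteration: positive definiteness, descent and small gradients *)

Section BfgsSequence.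
Variables (R : realType) (n : nat) (f : 'cV[R]_n -> R) (x : nat -> 'cV[R]_n).
Variables (mu nu : R) (H0 : 'M[R]_n).
Hypotheses (mu_gt0 : 0 < mu) (nu_lt1 : nu < 1) (H0pd : pos_def H0).

Let g k := grad f (x k).
Let s k := x k.+1 - x k.
Let y k := g k.+1 - g k.
Let H := bfgs_H f x H0.

Hypothesis g_neq0 : forall k, g k != 0.
Hypothesis direction : forall k, exists t : R, 0 <= t /\ H k *m g k = - (t *: s k).
Hypothesis armijo : forall k, f (x k.+1) <= f (x k) + mu * dotv (g k) (s k).
Hypothesis wolfe : forall k, nu * dotv (g k) (s k) <= dotv (g k.+1) (s k).

(** [<g, H g> > 0] forces [t > 0] in the direction condition, and [lam = 1 / t] is the step length.
    Positive definiteness is a premise because the induction in [bfgs_H_pos_def] uses this result at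
    stage [k] to reach [k.+1]. *)
Let step_of_pos_def k : pos_def (H k) ->
  exists lam : R, [/\ 0 < lam, invmx (H k) *m s k = - (lam *: g k) &
    dotv (g k) (s k) < 0].
Proof.
move=> Hpd; have Hu := pos_def_unit Hpd; have [t [t0 Hg]] := direction k.
have gHg : 0 < dotv (g k) (H k *m g k) by case: Hpd => _; apply.
rewrite Hg dotvNr dotvZr oppr_gt0 in gHg.
have t_gt0 : 0 < t.
  by rewrite lt_def t0 andbT; apply: contraTneq gHg => ->; rewrite mul0r ltxx.
exists t^-1; rewrite invr_gt0; split=> //; last by rewrite -(pmulr_rlt0 _ t_gt0).
rewrite -[g k](mulKmx Hu) Hg mulmxN -scalemxAr scalerN opprK scalerA.
by rewrite mulVf ?scale1r// gt_eqF.
Qed.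

Let curvature k : (1 - nu) * - dotv (g k) (s k) <= dotv (s k) (y k).
Proof.
rewrite (dotvC (s k)) dotvBl mulrN mulrBl mul1r opprB lerD2r.
exact: wolfe.
Qed.

Lemma bfgs_H_pos_def k : pos_def (H k).
Proof.
elim: k => [//|k Hpd]; have [lam [_ _ gs0]] := step_of_pos_def Hpd.
apply: bfgs_step_pos_def => //; apply: lt_le_trans (curvature k).
by rewrite mulr_gt0 ?subr_gt0 ?oppr_gt0.
Qed.

Lemma bfgs_descent_direction k : dotv (g k) (s k) < 0.
Proof. by have [lam []] := step_of_pos_def (bfgs_H_pos_def k). Qed.

Lemma bfgs_liminf_grad (M m : R) :
  (forall k, dotv (y k) (y k) <= M * dotv (s k) (y k)) ->
  (forall k, m <= f (x k)) ->
  forall e, 0 < e -> exists k, dotv (g k) (g k) < e.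
Proof.
move=> yM fm.
have gs0 := bfgs_descent_direction.
have nu0 : 0 < 1 - nu by rewrite subr_gt0.
have sy0 k : 0 < dotv (s k) (y k).
  by apply: lt_le_trans (curvature k); rewrite mulr_gt0 ?oppr_gt0.
have [lam lamP] := choice (fun k => step_of_pos_def (bfgs_H_pos_def k)).
have lam0 k : 0 < lam k by case: (lamP k).
have Bs k : invmx (H k) *m s k = - (lam k *: g k) by case: (lamP k).
have sig k : dotv (s k) (invmx (H k) *m s k) = lam k * - dotv (g k) (s k).
  by rewrite Bs dotvNr dotvZr dotvC mulrN.
have trS k : \tr (invmx (H k.+1)) = \tr (invmx (H k)) -
    dotv (invmx (H k) *m s k) (invmx (H k) *m s k) /
    dotv (s k) (invmx (H k) *m s k) + dotv (y k) (y k) / dotv (s k) (y k).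
  exact: (bfgs_step_trace (bfgs_H_pos_def k) (sy0 k)).
have detS k : \det (invmx (H k.+1)) = \det (invmx (H k)) *
    (dotv (s k) (y k) / dotv (s k) (invmx (H k) *m s k)).
  exact: (bfgs_step_det (bfgs_H_pos_def k) (sy0 k)).
have M0 : 0 <= M.
  have := le_trans (dotv_ge0 (y 0%N)) (yM 0%N).
  by rewrite pmulr_lge0.
(* [T] and [D] are the trace and the absolute determinant of the inverse of [H k]. Since
   [invmx (H k) *m s k] is [- lam k *: g k], the trace loses [lam b / a] and gains at most [M],
   while [curvature] makes the determinant ratio at least [(1 - nu) / lam]. *)
apply: (@powell_liminf R n (fun k => \tr (invmx (H k)))
  (fun k => `|\det (invmx (H k))|) (fun k => - dotv (g k) (s k))
  (fun k => dotv (g k) (g k)) lam M (1 - nu) n`!%:R ((f (x 0%N) - m) / mu)) => //.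
- by rewrite divr_ge0 ?subr_ge0// ltW.
- by move=> k; apply: pos_def_trace_ge0; exact/pos_def_inv/bfgs_H_pos_def.
- move=> k; rewrite normr_gt0 -unitfE -unitmxE unitmx_inv.
  exact/pos_def_unit/bfgs_H_pos_def.
- by move=> k; rewrite oppr_gt0.
- move=> k /=.
  rewrite trS sig Bs.
  rewrite dotvNl dotvNr opprK dotvZl dotvZr.
  have -> : lam k * (lam k * dotv (g k) (g k)) / (lam k * - dotv (g k) (s k)) =
      lam k * dotv (g k) (g k) / - dotv (g k) (s k).
    by field; rewrite lt_eqF//= gt_eqF.
  by rewrite lerD2l ler_pdivrMr.
- move=> k /=.
  rewrite detS sig normrM.
  rewrite ler_wpM2l// ger0_norm; last first.
    by rewrite divr_ge0 ?mulr_ge0// ?oppr_ge0 ltW.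
  rewrite ler_pdivlMr ?mulr_gt0 ?oppr_gt0//.
  apply: le_trans (curvature k); rewrite le_eqVlt; apply/orP; left; apply/eqP.
  by field; rewrite gt_eqF.
- by move=> k; apply: pos_def_det_le_trace; exact/pos_def_inv/bfgs_H_pos_def.
- apply: (@sum_decrease_le R (fun k => f (x k))
    (fun k => - dotv (g k) (s k))) => // k.
  by rewrite mulrN opprK armijo.
Qed.

End BfgsSequence.

(** * Convex functions: tangents, Jensen's inequality, local bounds, sublevel sets *)

Section ConvexFunctions.
Variables (R : realType) (n : nat).
Implicit Types (U : set 'cV[R]_n) (f : 'cV[R]_n -> R) (u v d z : 'cV[R]_n).

Lemma colE_evec v : v = \sum_(i < n) v i 0 *: evec R i.
Proof.
by rewrite [LHS]matrix_sum_delta; apply: eq_bigr => i _; rewrite big_ord1.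
Qed.

Lemma diff_dotv_grad f u v : differentiable f u -> 'd f u v = dotv (grad f u) v.
Proof.
move=> fu; rewrite {1}[v]colE_evec linear_sum; apply: eq_bigr => i _.
by rewrite linearZ mxE/= mulrC.
Qed.

(** Convexity bounds the quotients [(f (u + h (z - u)) - f u) / h] with [0 < h <= 1] by [f z - f u];
    their limit from the right at [0] is the directional derivative. *)
Lemma convex_grad_le U f u z : convex_on U f -> U u -> U z ->
  differentiable f u -> f u + dotv (grad f u) (z - u) <= f z.
Proof.
move=> fcvx Uu Uz fu; rewrite addrC -lerBrDr -diff_dotv_grad// -deriveE//.
have /cvg_dnbhs_at_right dr : h^-1 *: ((f \o shift u) (h *: (z - u)) - f u)
    @[h --> 0^'] --> 'D_(z - u) f u by exact: diff_derivable.
apply: (cvgr_to_le dr); near=> h.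
have h0 : 0 < h by near: h; exact: nbhs_right_gt.
have h1 : h <= 1 by near: h; exact: nbhs_right_le.
rewrite /= [_ *: _]mulrC ler_pdivrMr//.
have -> : h *: (z - u) + u = h *: z + (1 - h) *: u.
  by rewrite scalerBr scalerBl scale1r -addrA [- _ + u]addrC.
have h01 : 0 <= h <= 1 by rewrite h1 ltW.
by move: (fcvx z u h Uz Uu h01); lra.
Unshelve. all: by end_near. Qed.

Lemma convex_mean_le U f (m : nat) (p : 'I_m -> 'cV[R]_n) : (0 < m)%N ->
  convex_set_R U -> convex_on U f -> (forall i, U (p i)) ->
  U (m%:R^-1 *: \sum_i p i) /\
  f (m%:R^-1 *: \sum_i p i) <= m%:R^-1 * \sum_i f (p i).
Proof.
move=> + Ucvx fcvx; case: m p => // m p _; elim: m p => [|m IH] p Up.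
  by rewrite !big_ord1 invr1 scale1r mul1r.
have [Ua fa] := IH (fun i => p (widen_ord (leqnSn m.+1) i)) (fun i => Up _).
rewrite !(big_ord_recr m.+1)/=.
set a := (m.+1%:R^-1 *: _) in Ua fa *; set b := p ord_max.
(* The weight of the mean of the first [m.+1] points in the mean of all [m.+2]. *)
pose t : R := m.+1%:R / m.+2%:R.
have m1 : m.+1%:R != 0 :> R by rewrite pnatr_eq0.
have m2 : m.+2%:R != 0 :> R by rewrite pnatr_eq0.
have tm : t / m.+1%:R = m.+2%:R^-1 by rewrite /t mulrAC divff// mul1r.
have t1 : 1 - t = m.+2%:R^-1.
  apply: (mulIf m2); rewrite mulVf// mulrBl mulfVK// mul1r.
  by rewrite -[m.+2%:R]natr1 addrAC subrr add0r.
have t01 : 0 <= t <= 1.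
  by rewrite divr_ge0 ?ler0n//= ler_pdivrMr ?ltr0n// mul1r ler_nat.
have e : m.+2%:R^-1 *: (\sum_(i < m.+1) p (widen_ord (leqnSn m.+1) i) + b) =
    t *: a + (1 - t) *: b.
  rewrite t1 scalerDr; congr (_ + _); by rewrite /a scalerA tm.
rewrite e; split; first exact: Ucvx Ua (Up _) t01.
apply: le_trans (fcvx _ _ _ Ua (Up _) t01) _.
rewrite mulrDr t1 lerD2r.
have [t0 _] := andP t01.
apply: (le_trans (ler_wpM2l t0 fa)).
by rewrite mulrA tm.
Qed.

(* Jensen's inequality for [u + d], the mean of the points
   [u + n * d_i * e_i]: this reduces upper bounds for a convex function to
   the coordinate directions. *)
Lemma convex_coord_le U f u d : (0 < n)%N ->
  convex_set_R U -> convex_on U f ->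
  (forall i, U (u + (n%:R * d i 0) *: evec R i)) ->
  U (u + d) /\
  f (u + d) <= n%:R^-1 * \sum_(i < n) f (u + (n%:R * d i 0) *: evec R i).
Proof.
move=> n0 Ucvx fcvx Up.
have nR : n%:R != 0 :> R by rewrite pnatr_eq0 -lt0n.
have -> : u + d = n%:R^-1 *: \sum_(i < n) (u + (n%:R * d i 0) *: evec R i).
  rewrite big_split/= sumr_const card_ord scalerDr -[u *+ n]scaler_nat scalerA mulVf//.
  rewrite scale1r scaler_sumr {1}[d]colE_evec; congr (_ + _).
  by apply: eq_bigr => i _; rewrite scalerA mulrA mulVf// mul1r.
exact: (convex_mean_le n0 Ucvx fcvx Up).
Qed.

Lemma norm_evec_le (t : R) (i : 'I_n) : `|t *: evec R i| <= `|t|.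
Proof.
rewrite norm_colE; apply: bigmax_le => // -[j k] _ /=.
rewrite !mxE; case: (_ && _); first by rewrite mulr1.
by rewrite mulr0 normr0.
Qed.

Lemma abs_coord_le_norm v i : `|v i 0| <= `|v|.
Proof.
rewrite norm_colE.
exact: (le_bigmax_cond _ (fun ij : 'I_n * 'I_1 => `|v ij.1 ij.2|) (j := (i, 0))).
Qed.

(** By [convex_coord_le] only points on the axes through [c] matter, and there convexity bounds [f]
    by its values at the two ends at distance [q]. *)
Lemma convex_locally_bounded U f c : (0 < n)%N -> open U ->
  convex_set_R U -> convex_on U f -> U c ->
  exists r K : R, 0 < r /\ forall u, `|u - c| < r -> U u /\ f u <= K.
Proof.
move=> n0 oU Ucvx fcvx Uc.
have /nbhs_ballP[r /= r0 rU] : nbhs c U by apply: open_nbhs_nbhs.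
have nR : 0 < n%:R :> R by rewrite ltr0n.
have inU v : `|v| < r -> U (c + v).
  by move=> vr; apply: rU; rewrite -ball_normE/= opprD addrA subrr add0r normrN.
pose q := r / 2.
have q0 : 0 < q by rewrite divr_gt0.
have qr : q < r by rewrite ltr_pdivrMr// mulr_natr mulr2n ltrDl.
pose h i := `|f (c + q *: evec R i)| + `|f (c + - q *: evec R i)|.
(* The division by [n] compensates the factor [n] by which Jensen's points stretch each
   coordinate. *)
exists (q / n%:R), (\sum_i h i); split; first by rewrite divr_gt0.
move=> u uc.
have dq i : `|n%:R * (u - c) i 0| <= q.
  rewrite normrM ger0_norm// mulrC -ler_pdivlMr//.
  exact: le_trans (abs_coord_le_norm _ _) (ltW uc).
have Up i : U (c + (n%:R * (u - c) i 0) *: evec R i).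
  by apply: inU; rewrite (le_lt_trans (norm_evec_le _ _))// (le_lt_trans (dq i)).
have [Uu fu] := convex_coord_le n0 Ucvx fcvx Up.
rewrite addrC subrK in Uu fu; split=> //; apply: (le_trans fu).
rewrite mulrC ler_pdivrMr// mulr_natr.
have h0 i : 0 <= h i by rewrite addr_ge0.
have -> : (\sum_i h i) *+ n = \sum_(i < n) \sum_j h j.
  by rewrite sumr_const card_ord.
apply: ler_sum => i _.
apply: (@le_trans _ _ (h i)); last by rewrite (bigD1 i)//= lerDl sumr_ge0.
set tau := n%:R * _.
have := dq i; rewrite -/tau ler_norml => /andP[tq1 tq2].
pose t := (1 + tau / q) / 2.
have tq : -1 <= tau / q <= 1.
  by rewrite ler_pdivlMr// ler_pdivrMr// mulN1r mul1r tq1.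
have t01 : 0 <= t <= 1 by rewrite /t; move: tq => /andP[]; lra.
have -> : c + tau *: evec R i =
    t *: (c + q *: evec R i) + (1 - t) *: (c + - q *: evec R i).
  rewrite !scalerDr !scalerA addrACA -!scalerDl; congr (_ + _ *: _).
    by rewrite addrCA subrr addr0 scale1r.
  by rewrite /t; field; rewrite gt_eqF.
have Uq (e : R) : `|e| <= q -> U (c + e *: evec R i).
  move=> eq; apply: inU.
  by rewrite (le_lt_trans (norm_evec_le _ _))// (le_lt_trans eq).
have U1 : U (c + q *: evec R i) by apply: Uq; rewrite ger0_norm// ltW.
have U2 : U (c + - q *: evec R i) by apply: Uq; rewrite normrN ger0_norm// ltW.
apply: (le_trans (fcvx _ _ _ U1 U2 t01)); move: t01 => /andP[t0 t1].
apply: lerD.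
  by apply: (le_trans (ler_norm _)); rewrite normrM ger0_norm// ler_piMl.
apply: (le_trans (ler_norm _)); rewrite normrM ger0_norm ?subr_ge0//.
by rewrite ler_piMl// gerBl.
Qed.

(** If [f c > a], the segment from a point [z] of the sublevel set very near [c] is prolonged
    through [c] to some [w] where still [f w <= K]; convexity on it gives a contradiction. *)
Lemma convex_sublevel_closed U f (a : R) c : (0 < n)%N -> open U ->
  convex_set_R U -> convex_on U f -> U c ->
  closure [set z | U z /\ f z <= a] c -> f c <= a.
Proof.
move=> n0 oU Ucvx fcvx Uc cl; rewrite leNgt; apply/negP => afc.
have [r [K [r0 rK]]] := convex_locally_bounded n0 oU Ucvx fcvx Uc.
have [|_ fcK] := rK c; first by rewrite subrr normr0.
have aK : 0 < K - a by rewrite subr_gt0 (lt_le_trans afc).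
(* [t (K - a)] is half of [f c - a], so [t K + (1 - t) a] lies strictly below [f c]. *)
pose t := (f c - a) / (2 * (K - a)).
have t0 : 0 < t by rewrite divr_gt0 ?subr_gt0// mulr_gt0.
have tK : t * (K - a) = (f c - a) / 2.
  by rewrite /t; field; rewrite gt_eqF.
have t1 : t <= 1.
  by rewrite ler_pdivrMr ?mul1r ?mulr_gt0//; move: aK; lra.
have [z [[Uz fz] /=]] := cl _ (nbhsx_ballx c _ (mulr_gt0 t0 r0)).
rewrite -ball_normE/= => cz.
pose w := z + t^-1 *: (c - z).
have [|Uw fw] := rK w.
  have -> : w - c = (t^-1 - 1) *: (c - z).
    by rewrite scalerBl scale1r opprB /w addrAC addrC addrA.
  rewrite normrZ ger0_norm ?subr_ge0 ?invf_ge1//.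
  apply: (@le_lt_trans _ _ (t^-1 * `|c - z|)).
    by rewrite ler_wpM2r// gerBl.
  by rewrite mulrC ltr_pdivrMr// mulrC.
have ce : c = t *: w + (1 - t) *: z.
  rewrite /w scalerDr scalerA divff ?gt_eqF// scale1r scalerBl scale1r.
  by rewrite -addrA [c - z + _]addrA subrK [RHS]addrC subrK.
have t01 : 0 <= t <= 1 by rewrite t1 ltW.
have := fcvx _ _ _ Uw Uz t01; rewrite -ce.
have : t * f w <= t * K by rewrite ler_wpM2l// ltW.
have : (1 - t) * f z <= (1 - t) * a by rewrite ler_wpM2l// subr_ge0.
by move: tK afc; lra.
Qed.

End ConvexFunctions.

(** * Quadratic upper models from second derivatives, and cocoercivity *)

Section SecondOrderBound.
Variables (R : realType) (n : nat).
Implicit Types (U : set 'cV[R]_n) (f : 'cV[R]_n -> R) (u v c d z : 'cV[R]_n).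

(** Both signs of [t] are covered, since a displacement along an axis may be negative. *)
Lemma MVT_from0 (phi dphi : R -> R) (t : R) :
  (forall r : R, `|r| <= `|t| -> is_derive r 1 phi (dphi r)) ->
  exists2 r : R, `|r| <= `|t| & phi t - phi 0 = dphi r * t.
Proof.
move=> dP.
have between (a b r : R) : a <= b -> `|a| <= `|t| -> `|b| <= `|t| -> r \in `[a, b] ->
    `|r| <= `|t|.
  move=> ab; rewrite !ler_norml in_itv/= => /andP[a1 _] /andP[_ b2] /andP[r1 r2].
  by rewrite (le_trans a1)//= (le_trans r2).
have mvt (a b : R) : a <= b -> `|a| <= `|t| -> `|b| <= `|t| ->
    exists2 r, `|r| <= `|t| & phi b - phi a = dphi r * (b - a).
  move=> ab at_ bt.
  have := @MVT_segment R phi dphi a b ab.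
  case=> [r rab||r rab phiE].
  - by apply: dP; apply: (between a b) => //; exact: subset_itv_oo_cc.
  - apply: derivable_within_continuous => r rab.
    by have [] := dP r (between _ _ _ ab at_ bt rab).
  - by exists r => //; exact: (between a b).
have [t0|t0] := leP 0 t.
  by have [|||r rt] := mvt 0 t; rewrite ?normr0 ?subr0//; exists r.
have [|||r rt e] := mvt t 0; rewrite ?normr0 ?(ltW t0)//; exists r => //.
by rewrite -opprB e sub0r mulrN opprK.
Qed.

Lemma is_derive_line f u v (t : R) : derivable f (t *: v + u) v ->
  is_derive t 1 (fun r => f (r *: v + u)) ('D_v f (t *: v + u)).
Proof.
have e : (fun h : R => h^-1 *: (((fun r => f (r *: v + u)) \o shift t) (h *: 1)
      - f (t *: v + u))) =
    (fun h : R => h^-1 *: ((f \o shift (t *: v + u)) (h *: v) - f (t *: v + u))).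
  by apply/funext => h /=; rewrite [h *: 1]mulr1 scalerDl addrA.
by move=> df; split; rewrite /derivable /derive e.
Qed.

(** Two applications of the mean value theorem; they give [B] in place of Taylor's [B / 2], which is
    harmless here. *)
Lemma second_order_le f u v (t B : R) :
  (forall r : R, `|r| <= `|t| -> [/\ derivable f (r *: v + u) v,
     derivable (fun z => 'D_v f z) (r *: v + u) v &
     `|'D_v (fun z => 'D_v f z) (r *: v + u)| <= B]) ->
  f (t *: v + u) <= f u + t * 'D_v f u + B * t ^+ 2.
Proof.
move=> fP.
have [r rt e1] := @MVT_from0 (fun r => f (r *: v + u))
  (fun r => 'D_v f (r *: v + u)) t
  (fun r rt => let: And3 h _ _ := fP r rt in is_derive_line h).
have [r' rr' e2] := @MVT_from0 (fun r => 'D_v f (r *: v + u))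
  (fun r => 'D_v (fun z => 'D_v f z) (r *: v + u)) r
  (fun q qr => let: And3 _ h _ := fP q (le_trans qr rt) in is_derive_line h).
have [_ _ bB] := fP r' (le_trans rr' rt).
rewrite scale0r add0r in e1 e2.
have : ('D_v f (r *: v + u) - 'D_v f u) * t <= B * t ^+ 2.
  rewrite e2; apply: (le_trans (ler_norm _)); rewrite !normrM -mulrA.
  rewrite -[t ^+ 2]real_normK ?num_real// expr2.
  by apply: ler_pM => //; rewrite ?mulr_ge0// ler_wpM2r.
by move: e1; lra.
Qed.

(* The single parameter [eta] is at once radius, inverse curvature and inverse
   slope bound, so that one compactness argument makes all three uniform.  Here
   [`|d|] is the maximum norm. *)
Definition quad_bound U f (G : 'cV[R]_n -> 'cV[R]_n) (eta : R) u : Prop :=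
  (forall i, `|G u i 0| <= eta^-1) /\
  forall d, `|d| <= eta ->
    U (u + d) /\ f (u + d) <= f u + dotv (G u) d + eta^-1 * dotv d d.

Lemma C2_quad_bound U f Ud fd c : (0 < n)%N ->
  convex_set_R U -> convex_on U f -> Ud `<=` U -> open Ud -> C2_on Ud fd ->
  Ud c -> (\forall z \near c, fd z = f z) ->
  exists2 eta0 : R, 0 < eta0 & forall eta u, 0 < eta -> eta < eta0 ->
    `|u - c| < eta0 ->
    quad_bound U f (fun z => \col_i 'D_(evec R i) fd z) eta u.
Proof.
move=> n0 Ucvx fcvx UdU oUd [_ [df [cdf [ddf cddf]]]] Udc fdf.
have nR : 0 < n%:R :> R by rewrite ltr0n.
have n1 : 1 <= n%:R :> R by rewrite ler1n.
(* The final [+ 1] makes the bounds strict at [c], hence valid near [c] by continuity. *)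
pose B := \sum_(i < n) (`|'D_(evec R i) fd c| +
  `|'D_(evec R i) (fun y => 'D_(evec R i) fd y) c|) + 1.
have Bi i : `|'D_(evec R i) fd c| < B /\
    `|'D_(evec R i) (fun y => 'D_(evec R i) fd y) c| < B.
  rewrite /B (bigD1 i)//=.
  set s := \sum_(_ < _ | _) _.
  have s0 : 0 <= s by apply: sumr_ge0 => j _; rewrite addr_ge0.
  have := normr_ge0 ('D_(evec R i) fd c).
  have := normr_ge0 ('D_(evec R i) (fun y => 'D_(evec R i) fd y) c).
  by move: `|_| `|_| s s0 => a b s; split; lra.
have B0 : 0 < B.
  by rewrite ltr_wpDl// sumr_ge0// => i _; rewrite addr_ge0.
have near_le (h : 'cV[R]_n -> R) : {within Ud, continuous h} -> `|h c| < B ->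
    \forall z \near c, `|h z| <= B.
  move=> ch hB; have {}ch : {for c, continuous h}.
    by move: ch; rewrite continuous_open_subspace// => ch; apply: ch; rewrite inE.
  exact: (cvgr_norm_le (h c) ch B hB).
have : \forall z \near c, [/\ Ud z, fd z = f z,
    forall i, `|'D_(evec R i) fd z| <= B &
    forall i, `|'D_(evec R i) (fun y => 'D_(evec R i) fd y) z| <= B].
  have nUd : \forall z \near c, Ud z by apply: open_nbhs_nbhs.
  have n1B : \forall z \near c, forall i, `|'D_(evec R i) fd z| <= B.
    apply: (@filter_forall _ _ (fun i z => `|'D_(evec R i) fd z| <= B) (nbhs c)) => i.
    exact: near_le (cdf i) (Bi i).1.
  have n2B : \forall z \near c, forall i,
      `|'D_(evec R i) (fun y => 'D_(evec R i) fd y) z| <= B.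
    apply: (@filter_forall _ _ (fun i z =>
      `|'D_(evec R i) (fun y => 'D_(evec R i) fd y) z| <= B) (nbhs c)) => i.
    exact: near_le (cddf i i) (Bi i).2.
  by near=> z; split; near: z.
move=> /nbhs_ballP[rho /= rho0 rhoP].
have {}rhoP z : `|z - c| < rho -> [/\ Ud z, fd z = f z,
    forall i, `|'D_(evec R i) fd z| <= B &
    forall i, `|'D_(evec R i) (fun y => 'D_(evec R i) fd y) z| <= B].
  by move=> zc; apply: rhoP; rewrite -ball_normE/= distrC.
(* The first term keeps Jensen's points [u + n d_i e_i] within [rho] of [c]; the second makes
   [eta^-1] at least [n B], the curvature left after averaging the terms [B (n d_i)^2]. *)
pose eta0 := Num.min (rho / 2 / n%:R) (n%:R * B)^-1.
have nB : 0 < n%:R * B by rewrite mulr_gt0.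
exists eta0 => [|eta u eta_gt0]; first by rewrite lt_min !divr_gt0//= invr_gt0.
rewrite !lt_min => /andP[eta1 eta2] /andP[uc1 _].
have rn : rho / 2 / n%:R <= rho / 2 by rewrite ler_pdivrMr// ler_peMr// divr_ge0// ltW.
have uc : `|u - c| < rho / 2 by apply: lt_le_trans rn.
have Beta : n%:R * B <= eta^-1.
  by rewrite -[leLHS]invrK lef_pV2 ?posrE ?invr_gt0// ltW.
have inball (t : R) (i : 'I_n) : `|t| <= n%:R * eta ->
    `|t *: evec R i + u - c| < rho.
  move=> tn; rewrite -addrA; apply: (le_lt_trans (ler_normD _ _)).
  rewrite [rho]splitr; apply: ler_ltD => //.
  apply: (le_trans (norm_evec_le _ _)); apply: (le_trans tn).
  by rewrite mulrC -ler_pdivlMr// ltW.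
have ucr : `|u - c| < rho.
  by apply: (lt_trans uc); rewrite ltr_pdivrMr// mulr_natr mulr2n ltrDl.
have [_ fdu G1 _] := rhoP u ucr.
split=> [i|d d_le].
  rewrite mxE; apply: (le_trans (G1 i)); apply: le_trans Beta.
  by rewrite ler_peMl// ltW.
have dn i : `|n%:R * d i 0| <= n%:R * eta.
  rewrite normrM ger0_norm// ler_pM2l//.
  exact: le_trans (abs_coord_le_norm _ _) d_le.
have Up i : U (u + (n%:R * d i 0) *: evec R i).
  by rewrite addrC; apply: UdU; have [] := rhoP _ (inball _ i (dn i)).
have [Uud fud] := convex_coord_le n0 Ucvx fcvx Up.
split=> //; apply: (le_trans fud).
rewrite mulrC ler_pdivrMr//.
have dirP i : f (u + (n%:R * d i 0) *: evec R i) <=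
    f u + n%:R * d i 0 * 'D_(evec R i) fd u + B * (n%:R * d i 0) ^+ 2.
  rewrite addrC; have [_ <- _ _] := rhoP _ (inball _ i (dn i)).
  rewrite -fdu; apply: second_order_le => r rd.
  have [Udr _ _ B2] := rhoP _ (inball _ i (le_trans rd (dn i))).
  by split; [exact: df|exact: ddf|exact: B2].
apply: (le_trans (ler_sum _ (fun i _ => dirP i))).
rewrite !big_split/= sumr_const card_ord !mulrDl mulr_natr -!addrA lerD2l.
apply: lerD.
  rewrite /dotv mulr_suml le_eqVlt; apply/orP; left; apply/eqP.
  by apply: eq_bigr => i _; rewrite mxE; ring.
apply: (@le_trans _ _ (n%:R * B * dotv d d * n%:R)).
  rewrite /dotv mulr_sumr mulr_suml le_eqVlt; apply/orP; left; apply/eqP.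
  by apply: eq_bigr => i _; ring.
by rewrite ler_pM2r// ler_wpM2r// dotv_ge0.
Unshelve. all: by end_near. Qed.

(* Comparing the tangent plane at [x] with the quadratic model at [x'] in the
   point [x' - kappa *: (g' - g)] gives cocoercivity of the gradient. *)
Lemma quad_bound_cocoercive U f G (eta : R) x x' : 0 < eta -> eta <= 1 ->
  convex_on U f -> U x -> U x' -> differentiable f x -> differentiable f x' ->
  G x = grad f x -> G x' = grad f x' ->
  quad_bound U f G eta x -> quad_bound U f G eta x' ->
  dotv (grad f x' - grad f x) (grad f x' - grad f x) <=
    4 / eta ^+ 2 * dotv (x' - x) (grad f x' - grad f x).
Proof.
move=> eta0 eta1 fcvx Ux Ux' dx dx' Gx Gx' [gx _] [gx' q].
rewrite {}Gx in gx; rewrite {}Gx' in gx' q.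
move: (convex_grad_le fcvx Ux' Ux dx') (fun z Uz => @convex_grad_le R n U f x z fcvx Ux Uz dx).
move: (grad f x) (grad f x') gx gx' q => g g' gx gx' q t' t.
pose y := g' - g; rewrite -/y.
(* The slope bounds give [|y| <= 2 / eta], so the displacement [kappa y] stays within radius [eta];
   with [eta <= 1] the quadratic term is at most [kappa / 2 <y, y>]. *)
pose kappa := eta ^+ 2 / 2.
have k0 : 0 < kappa by rewrite divr_gt0// exprn_gt0.
have yn : `|- (kappa *: y)| <= eta.
  rewrite normrN normrZ ger0_norm; last exact: ltW.
  have : `|y| <= 2 / eta.
    rewrite norm_colE; apply: bigmax_le => [|[i j] _ /=].
      by rewrite divr_ge0// ltW.
    rewrite (ord1 j) !mxE; apply: (le_trans (ler_normB _ _)).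
    by move: (gx i) (gx' i); rewrite -div1r; lra.
  move=> /(ler_wpM2l (ltW k0)) /le_trans; apply.
  by rewrite /kappa le_eqVlt; apply/orP; left; apply/eqP; field; rewrite gt_eqF.
have [Uz fz] := q _ yn.
have := t _ Uz.
have -> : x' - kappa *: y - x = (x' - x) - kappa *: y by rewrite addrAC.
have -> : 4 / eta ^+ 2 = 2 / kappa by rewrite /kappa; field; rewrite gt_eqF.
rewrite dotvBr dotvZr => h.
move: fz; rewrite dotvNr dotvZr dotvNl dotvNr opprK dotvZl dotvZr => fz.
have ke : eta^-1 * (kappa * (kappa * dotv y y)) <= kappa / 2 * dotv y y.
  have -> : eta^-1 * (kappa * (kappa * dotv y y)) = kappa / 2 * (eta * dotv y y).
    by rewrite /kappa; field; rewrite gt_eqF.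
  apply: ler_wpM2l; first by rewrite divr_ge0// ltW.
  by rewrite ler_piMl// dotv_ge0.
rewrite mulrAC ler_pdivlMr//.
have yy : dotv y y = dotv g' y - dotv g y by rewrite dotvBl.
have sy : dotv (x' - x) y = dotv g' (x' - x) - dotv g (x' - x).
  by rewrite dotvC dotvBl.
have gN : dotv g' (x - x') = - dotv g' (x' - x) by rewrite -dotvNr opprB.
rewrite sy; rewrite gN in t'.
set w := eta^-1 * _ in fz ke; move: w fz ke => w fz; rewrite yy => ke.
(* The tangent inequalities at [x] and [x'] and the model at [x'] add up to
   [kappa / 2 <y, y> <= <x' - x, y>]. *)
by move: (dotv g' y) (dotv g y) (dotv g' (x' - x)) (dotv g (x' - x)) t' h fz ke =>
  a b p r; lra.
Qed.

End SecondOrderBound.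

(** * Compactness of closures of bounded sets of columns *)

Section CompactColumns.
Variables (R : realType) (n : nat).

Lemma trmx_row_continuous : continuous (trmx : 'rV[R]_n -> 'cV[R]_n).
Proof.
move=> v A /nbhs_ballP[e /= e0 eA]; apply/nbhs_ballP; exists e => // w [_ vw].
by apply: eA; split=> // i j; rewrite !mxE.
Qed.

(** Heine-Borel for row vectors is carried to columns by transposition, which preserves the maximum
    norm. *)
Lemma compact_closure_col (A : set 'cV[R]_n) (M : R) :
  (forall z, A z -> `|z| <= M) -> compact (closure A).
Proof.
move=> AM; pose A' : set 'rV[R]_n := trmx @^-1` closure A.
have -> : closure A = trmx @` A'.
  apply/seteqP; split=> [z Az|_ [z Az <-]//].
  by exists z^T; rewrite /A' /= ?trmxK.
apply: continuous_compact.
  exact/continuous_subspaceT/trmx_row_continuous.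
apply: bounded_closed_compact; last first.
  apply: preimage_closed; last exact: closed_closure.
  by move=> v _; exact: trmx_row_continuous.
(* Every point of the closure is within distance [1] of a point of [A]. *)
exists (M + 1); split; first exact: num_real.
move=> N MN v /= Av; apply: le_trans (ltW MN).
have [z [Az]] := Av _ (nbhsx_ballx v^T _ ltr01).
rewrite -ball_normE/= => vz.
have -> : `|v| = `|v^T|.
  apply/eqP; rewrite eq_le; apply/andP; split.
    rewrite [leLHS]mx_normrE; apply: bigmax_le => // -[i j] _ /=.
    by rewrite (ord1 i) -[v 0 j](mxE trmx_key (fun k l => v l k)) abs_coord_le_norm.
  rewrite norm_colE; apply: bigmax_le => // -[i j] _ /=; rewrite mxE [leRHS]mx_normrE.
  exact: (le_bigmax_cond _ (fun ij : 'I_1 * 'I_n => `|v ij.1 ij.2|) (j := (j, i))).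
rewrite -[v^T](subrK z) addrC; apply: (le_trans (ler_normD _ _)).
by rewrite lerD ?AM// ltW.
Qed.

End CompactColumns.

(** * Distance to the complement, and local properties made uniform on compact sets *)

Section Neighbourhoods.
Variables (R : realType) (n : nat).

(** If the ball of radius [r] at [c] lies in [V], points outside [V] are at distance at least
    [r / 2] from any [z] within [r / 2] of [c], in the maximum norm and so in the Euclidean one. *)
Lemma dist_compl_near (V : set 'cV[R]_n) c : open V -> V c ->
  exists2 r : R, 0 < r & forall z (delta : R), `|z - c| < r -> delta < r ->
    (delta%:E < dist_compl V z)%E.
Proof.
move=> oV Vc; have /nbhs_ballP[r /= r0 rV] : nbhs c V by apply: open_nbhs_nbhs.
exists (r / 2) => [|z delta zc dr]; first by rewrite divr_gt0.
apply: (@lt_le_trans _ _ (r / 2)%:E); first by rewrite lte_fin.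
apply/ereal_infP => _ [w Vw <-]; rewrite lee_fin leNgt; apply/negP => wz.
apply: Vw; apply: rV; rewrite -ball_normE/= distrC -(subrK z w) -addrA.
apply: (le_lt_trans (ler_normD _ _)); rewrite [r]splitr; apply: ltrD => //.
exact: le_lt_trans (norm_le_enorm _) wz.
Qed.

(** Near-covering compactness for the filter of positive [e] tending to [0]. The local premise
    speaks of all small [e] at once, so [P] need not be monotone in [e]. *)
Lemma compact_uniform_radius (C : set 'cV[R]_n) (P : R -> 'cV[R]_n -> Prop) :
  compact C ->
  (forall c, C c -> exists2 r : R, 0 < r &
    forall e u, 0 < e -> e < r -> `|u - c| < r -> P e u) ->
  exists2 e : R, 0 < e <= 1 & forall c, C c -> P e c.
Proof.
move=> /compact_near_coveringP cC locP.
have : \forall e \near (0 : R)^'+, C `<=` P e.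
  apply: cC => c Cc; have [r r0 rP] := locP c Cc.
  exists ([set u | `|u - c| < r], [set e : R | 0 < e < r]) => /=.
    split.
      by apply/nbhs_ballP; exists r => //= u; rewrite -ball_normE/= distrC.
    near=> e; apply/andP; split; near: e; [exact: nbhs_right_gt|].
    exact: nbhs_right_lt.
  by move=> [u e] /= [uc /andP[e0 er]]; exact: rP.
move=> near_P.
have : \forall e \near (0 : R)^'+, 0 < e <= 1 /\ C `<=` P e.
  near=> e; split; last by near: e.
  apply/andP; split; near: e; [exact: nbhs_right_gt|exact: nbhs_right_le].
by move=> /filter_ex[e [e01 CP]]; exists e.
Unshelve. all: by end_near. Qed.

End Neighbourhoods.

(** * Convergence of the function values to the infimum *)

Theorem theorem4p3 (R : realType) (n : nat) (U : set 'cV[R]_n)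
  (f : 'cV[R]_n -> R) (x : nat -> 'cV[R]_n) (V : set 'cV[R]_n) :
  open U -> convex_set_R U -> convex_on U f ->
  bfgs_sequence f x -> (forall k, U (x k)) ->
  ebounded [set z | U z /\ f z <= f (x 0%N)] ->
  open V -> V `<=` U -> closure (range x) `<=` V ->
  inf_on f V = inf_on f U ->
  (forall delta : R, 0 < delta ->
     exists (Ud : set 'cV[R]_n) (fd : 'cV[R]_n -> R),
       [/\ open Ud, convex_set_R Ud, Ud `<=` U &
           [set z | U z /\ f z <= f (x 0%N)] `<=` Ud] /\
       [/\ C2_on Ud fd, convex_on Ud fd &
           forall z, Ud z -> (delta%:E < dist_compl V z)%E -> fd z = f z]) ->
  (fun k => (f (x k))%:E) @ \oo --> inf_on f U.
Proof.
move=> oU Ucvx fcvx [xdiff [mu [nu [H0 [mu0 munu nu1 H0pd steps]]]]] Ux [M xM].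
move=> oV VU clV _ smooth.
(* In dimension [0] every gradient vanishes, which a BFGS sequence excludes. *)
have n0 : (0 < n)%N.
  rewrite lt0n; apply: contraTneq (xdiff 0%N).2 => n_eq0; rewrite negbK.
  by apply/eqP/colP => i; have := ltn_ord i; rewrite {2}n_eq0.
have fx k : differentiable f (x k) := (xdiff k).1.
have g_neq0 k : grad f (x k) != 0 := (xdiff k).2.
have direction k := let: And3 h _ _ := steps k in h.
have armijo k := let: And3 _ h _ := steps k in h.
have wolfe k := let: And3 _ _ h := steps k in h.
have fdecr : {homo (fun k => f (x k)) : i j / (i <= j)%N >-> j <= i}.
  apply/nonincreasing_seqP => k; apply: (le_trans (armijo k)).
  rewrite gerDl pmulr_rle0// ltW//.
  exact: (bfgs_descent_direction nu1 H0pd g_neq0 direction wolfe).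
have level k : [set z | U z /\ f z <= f (x 0%N)] (x k).
  by split => //; exact: (fdecr 0%N k).
pose C := closure (range x).
have cC : compact C.
  apply: (@compact_closure_col _ _ _ M) => _ [k _ <-].
  exact: le_trans (norm_le_enorm _) (xM _ (level k)).
have Cx k : C (x k) by apply: subset_closure; exists k.
(* The bound is kept on a neighbourhood of each point of [C], so that [fd] and [f] agree near it and
   share their derivatives there. *)
have [delta /andP[delta0 _] deltaP] : exists2 delta : R, 0 < delta <= 1 &
    forall c, C c -> \forall z \near c, (delta%:E < dist_compl V z)%E.
  apply: compact_uniform_radius => // c Cc.
  have [r r0 rP] := dist_compl_near oV (clV _ Cc).
  exists (r / 2) => [|e u e0 er uc]; first by rewrite divr_gt0.
  apply/nbhs_ballP; exists (r / 2) => /=; first by rewrite divr_gt0.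
  move=> z; rewrite -ball_normE/= distrC => zu.
  apply: rP; last by rewrite (lt_trans er)// ltr_pdivrMr// mulr_natr mulr2n ltrDl.
  rewrite -(subrK u z) -addrA (le_lt_trans (ler_normD _ _))// [r]splitr.
  exact: ltrD.
have [Ud [fd [[oUd _ UdU levUd] [fdC2 _ fdf]]]] := smooth delta delta0.
(* [Ud] contains the level set, which is closed relative to [U] and so holds the limit points of the
   iterates. *)
have UdC c : C c -> Ud c.
  move=> Cc; apply: levUd; have Uc : U c by apply/VU/clV.
  split=> //; apply: (convex_sublevel_closed n0 oU Ucvx fcvx Uc).
  by apply: closureS Cc => _ [k _ <-]; exact: level.
have fdf_near c : C c -> \forall z \near c, fd z = f z.
  move=> Cc; have nUd : \forall z \near c, Ud z.
    by apply: open_nbhs_nbhs; split=> //; exact: UdC.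
  have nd := deltaP c Cc.
  near=> z; apply: fdf; near: z; [exact: nUd|exact: nd].
(* Compactness calls for a gradient field on all of [C], while [f] is assumed differentiable only at
   the iterates; the partial derivatives of [fd] supply it. *)
pose G z := \col_i 'D_(evec R i) fd z : 'cV[R]_n.
have [eta /andP[eta0 eta1] etaP] : exists2 eta : R, 0 < eta <= 1 &
    forall c, C c -> quad_bound U f G eta c.
  apply: compact_uniform_radius => // c Cc.
  have [r r0 rP] := C2_quad_bound n0 Ucvx fcvx UdU oUd fdC2 (UdC _ Cc)
    (fdf_near _ Cc).
  by exists r.
have Gx k : G (x k) = grad f (x k).
  apply/colP => i; rewrite !mxE -deriveE//.
  exact/near_eq_derive/fdf_near.
have secant k : dotv (grad f (x k.+1) - grad f (x k))
      (grad f (x k.+1) - grad f (x k)) <=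
    4 / eta ^+ 2 * dotv (x k.+1 - x k) (grad f (x k.+1) - grad f (x k)).
  exact: (quad_bound_cocoercive eta0 eta1 fcvx (Ux k) (Ux k.+1) (fx k) (fx k.+1)
    (Gx k) (Gx k.+1) (etaP _ (Cx k)) (etaP _ (Cx k.+1))).
have M0 : 0 <= M := le_trans (enorm_ge0 _) (xM _ (level 0%N)).
have below k : f (x 0%N) - (enorm (grad f (x 0%N)) * M
    + dotv (grad f (x 0%N)) (x 0%N)) <= f (x k).
  have := convex_grad_le fcvx (Ux 0%N) (Ux k) (fx 0%N).
  apply: le_trans; rewrite lerD2l opprD dotvBr lerB// -[leRHS]opprK lerN2.
  rewrite -dotvNr; apply: (le_trans (dotv_le_enorm _ _)).
  by rewrite enormN ler_wpM2l ?enorm_ge0 ?(xM _ (level k)).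
have liminf := bfgs_liminf_grad mu0 nu1 H0pd g_neq0 direction armijo wolfe
  secant below.
(* A nonincreasing sequence tends to the infimum of its range, so only the two infima have to be
   compared. *)
have -> : inf_on f U = ereal_inf (range (fun k => (f (x k))%:E)).
  apply/eqP; rewrite eq_le; apply/andP; split.
    by apply: ereal_inf_le_tmp => _ [k _ <-]; exists (x k).
  apply/ereal_infP => _ [z Uz <-]; apply/lee_addgt0Pr => e e0.
  (* [L] exceeds [|x_k| + |z|] for every [k], so a gradient of length at most [e / L] gives
     [f (x_k) <= f z + e] by the tangent inequality. *)
  pose L := M + enorm z + 1.
  have L0 : 0 < L by rewrite ltr_wpDl// addr_ge0// enorm_ge0.
  have [k gk] := liminf ((e / L) ^+ 2) (exprn_gt0 _ (divr_gt0 e0 L0)).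
  have gke : enorm (grad f (x k)) <= e / L.
    rewrite -(@ler_pXn2r _ 2)// ?nnegrE ?enorm_ge0// ?divr_ge0 ?(ltW e0) ?(ltW L0)//.
    by rewrite sqr_enorm ltW.
  apply: (@le_trans _ _ (f (x k))%:E).
    by apply: ereal_inf_lbound; exists k.
  rewrite -EFinD lee_fin.
  have := convex_grad_le fcvx (Ux k) Uz (fx k).
  rewrite -lerBrDr => /le_trans; apply; rewrite lerD2l.
  rewrite -dotvNr opprB dotvBr -dotvNr.
  have := dotv_le_enorm (grad f (x k)) (x k).
  have := dotv_le_enorm (grad f (x k)) (- z); rewrite enormN => h1 h2.
  apply: (le_trans (lerD h2 h1)); rewrite -mulrDr.
  apply: (@le_trans _ _ (e / L * L)); last by rewrite divfK// gt_eqF.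
  apply: ler_pM => //; rewrite ?enorm_ge0 ?addr_ge0 ?enorm_ge0//.
  by rewrite /L -addrA lerD ?(xM _ (level k))// lerDl.
apply: ereal_nonincreasing_cvgn => i j ij; rewrite lee_fin; exact: fdecr.
Unshelve. all: by end_near. Qed.
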